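(* Let $\mathcal B$ be an ordered Bratteli diagram satisfying the standing conditions (a)--(d) of the context, and suppose that $X'=X\setminus\{x_s\}$ contains a unique minimal path $x$ and that $x$ is forward transitive. Then the $1$-coding $\omega=\phi_1(x)$ is periodic if and only if there is an $N$ such that for every $n\ge N$, level $n$ satisfies the local deficit condition with respect to level $1$, i.e. $LDC(n,1)$ holds.
   Context: Diagram. $\mathcal B=(\mathcal V,\mathcal E,\le)$ is an ordered Bratteli diagram with finitely many vertices $v(n,1),\dots,v(n,K_n+1)$ at each level $n\ge 0$, $K_0=0$ (level $0$ consists of the root $v(0,1)$), and finitely many edges $\mathcal E_n$ directed from level $n$ to level $n+1$; $s$ and $r$ map an edge to its source and terminal vertex. Every vertex is the source of at least one edge and every vertex except the root is the range of at least one edge. The edges with a common range are totally ordered. Standing conditions: (a) $K_n\ge1$ for all $n\ge1$; (b) for every $n\ge 1$ the spacer vertex $v(n,K_n+1)$ has exactly one incoming edge, with source $v(n-1,K_{n-1}+1)$; (c) for each $n\ge 2$ and $j\le K_n$, the minimal edge into $v(n,j)$ does not have the spacer vertex $v(n-1,K_{n-1}+1)$ as its source; (d) (growing) $\lim_{n\to\infty}\min\{|B^{(1)}(n,j)|: j\le K_n\}=\infty$, with $B^{(1)}(n,j)$ defined below. Dynamics. $X$ is the space of infinite directed paths $x=x_0x_1\cdots$ from the root, $x_i\in\mathcal E_i$. A path is minimal (maximal) if all its edges are minimal (maximal) among edges with the same range. The adic transformation $T$ is defined on non-maximal paths: if $i$ is least such that $x_i$ is not maximal, replace $x_i$ by its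 successor $y_i$ and $x_0\cdots x_{i-1}$ by the segment of minimal edges from the root to $s(y_i)$. The path $x_s$ is the unique path through $v(n,K_n+1)$ for all $n>0$, and $T(x_s)=x_s$. A path is forward transitive if its forward orbit $\{T^ix:i\ge0\}$ meets every nonempty cylinder set. Codings. For $k\ge1$ let $A_k$ be the finite set of segments from the root to level $k$, regarded as an alphabet; the unique segment to $v(k,K_k+1)$ is the spacer symbol $s_k$. Let $\alpha_k(x)\in A_k$ be the initial $k$-edge segment of $x$, and $\phi_k(x)=\alpha_k(x)\alpha_k(Tx)\alpha_k(T^2x)\cdots$ the $k$-coding of $x$. A sequence is periodic if it equals $PPP\cdots$ for a finite nonempty word $P$. For $n\ge k$, let $\dim(n,j)$ be the number of segments from the root to $v(n,j)$; the basic block $B^{(k)}(n,j)=\alpha_k(y)\alpha_k(Ty)\cdots\alpha_k(T^{\dim(n,j)-1}y)$, where $y$ is any path following only minimal edges from the root to $v(n,j)$. Listing the edges into $v(n+1,i)$, $i\le K_{n+1}$, in increasing order and concatenating the basic blocks of their sources (each spacer vertex contributing $s_k$) gives the explicit decomposition $$B^{(k)}(n+1,i)=B^{(k)}(n,j_1)s_k^{a_1}B^{(k)}(n,j_2)s_k^{a_2}\cdots B^{(k)}(n,j_m)s_k^{a_m},\quad j_1,\dots,j_m\in\{1,\dots,K_n\},\ a_1,\dots,a_m\ge0.$$ Semi $k$-periodic. Level $n\ge k$ is semi $k$-periodic if there exist $c_n\ge0$ and a nonempty word $U_n$ over $A_k$, neither beginning nor ending with $s_k$, such that for every $j=1,\dots,K_n$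 there are $t(n,j)>0$ and $0\le l(n,j)\le c_n$ with $B^{(k)}(n,j)=(U_ns_k^{c_n})^{t(n,j)}U_ns_k^{l(n,j)}$; $U_n$ denotes the shortest such word, with corresponding $c_n$, $t(n,j)$, $l(n,j)$. Local deficit condition. $LDC(n,k)$ holds if level $n$ is semi $k$-periodic and, for each $i=1,\dots,K_{n+1}$, the explicit decomposition of $B^{(k)}(n+1,i)$ above satisfies $a_r=c_n-l(n,j_r)$ for $1\le r<m$ and $a_m\le c_n-l(n,j_m)$. *)

(* Defs.v *)
From mathcomp Require Import all_boot.
From mathcomp Require Import boolp.

Set Implicit Arguments.
Unset Strict Implicit.
Unset Printing Implicit Defensive.

(* The vertices at level n are the ordinals 0, ..., K n, so that v(n, j) is the
   ordinal j - 1 and the spacer vertex v(n, K_n + 1) is ord_max. *)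
Record bratteli := Bratteli {
  K : nat -> nat;
  K0 : K 0 = 0;
  edge : nat -> finType;
  src : forall n, edge n -> 'I_(K n).+1;
  rng : forall n, edge n -> 'I_(K n.+1).+1;
  src_surj : forall n (v : 'I_(K n).+1), exists e : edge n, src e == v;
  rng_surj : forall n (v : 'I_(K n.+1).+1), exists e : edge n, rng e == v;
  ele : forall n, rel (edge n);
  ele_refl : forall n, reflexive (@ele n);
  ele_anti : forall n, antisymmetric (@ele n);
  ele_trans : forall n, transitive (@ele n);
  ele_comparable : forall n (e f : edge n), ele e f || ele f e = (rng e == rng f);
  (* These two conditions on the spacer vertices are part of the structure
     because the path x_s and the spacer symbols s_k exist only under them. *)
  spacer_uniq : forall n (e f : edge n),
    rng e = ord_max -> rng f = ord_max -> e = f;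
  spacer_src : forall n (e : edge n), rng e = ord_max -> src e = ord_max
}.

Section Diagram.
Variable B : bratteli.
Implicit Types (n k i : nat).

Definition is_min n (e : edge B n) := [forall f, (rng f == rng e) ==> ele e f].
Definition is_max n (e : edge B n) := [forall f, (rng f == rng e) ==> ele f e].
Definition is_succ n (e f : edge B n) :=
  [&& ele e f, e != f & [forall g, ele e g && (e != g) ==> ele f g]].

(* There is no condition on the source of x_0: the root is the only vertex
   at level 0, by K0. *)
Record bpath := BPath {
  bp :> forall n, edge B n;
  bpP : forall n, rng (bp n) = src (bp n.+1)
}.

Definition minimal (x : bpath) := forall n, is_min (x n).
Definition maximal (x : bpath) := forall n, is_max (x n).

Definition spacer_edge n : edge B n := xchoose (rng_surj (ord_max : 'I_(K B n.+1).+1)).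

Lemma rng_spacer_edge n : rng (spacer_edge n) = ord_max.
Proof. exact/eqP/(xchooseP (rng_surj (ord_max : 'I_(K B n.+1).+1))). Qed.

Lemma spacer_edgeP n : rng (spacer_edge n) = src (spacer_edge n.+1).
Proof. by rewrite rng_spacer_edge spacer_src // rng_spacer_edge. Qed.

Definition xs : bpath := BPath spacer_edgeP.

Definition the (d : bpath) (P : bpath -> Prop) : bpath :=
  if pselect (exists y, P y) is left h then projT1 (cid h) else d.

(* Since y is a path, its minimal edges below level i form the minimal segment
   from the root to the source of y_i. *)
Definition adic_step (x y : bpath) := exists i,
  [/\ forall m, m < i -> is_max (x m),
      ~~ is_max (x i) /\ is_succ (x i) (y i),
      forall m, m < i -> is_min (y m)
    & forall m, i < m -> y m = x m].

(* The adic transformation, extended to all paths by fixing the maximal ones.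
   For x_s this is the required value. The value at another maximal path plays
   no role if B is growing and K n > 0 for n > 0: a forward orbit reaching it is
   finite, so it is not that of a forward transitive path. *)
Definition adic (x : bpath) : bpath := the x (adic_step x).

(* Sequences e_0, ..., e_(k-1) of edges, as nested pairs. *)
Fixpoint rawseg k : finType :=
  if k is k'.+1 then (rawseg k' * edge B k')%type else unit.

(* s is a segment from the root to the vertex v of level k *)
Fixpoint seg_to k : rawseg k -> 'I_(K B k).+1 -> bool :=
  if k is k'.+1 then fun s v => seg_to s.1 (src s.2) && (rng s.2 == v)
  else fun _ _ => true.

Definition dim n (v : 'I_(K B n).+1) := #|[set s : rawseg n | seg_to s v]|.

Definition A k : finType := {s : rawseg k | [exists v, seg_to s v]}.

Fixpoint prefix_of k (x : bpath) : rawseg k :=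
  if k is k'.+1 then (prefix_of k' x, x k') else tt.

Lemma prefix_ofP k x : seg_to (prefix_of k x) (src (x k)).
Proof. by elim: k => //= k IHk; rewrite IHk bpP eqxx. Qed.

Lemma prefix_of_seg k x : [exists v, seg_to (prefix_of k x) v].
Proof. by apply/existsP; exists (src (x k)); apply: prefix_ofP. Qed.

Definition alpha k (x : bpath) : A k := Sub (prefix_of k x) (prefix_of_seg k x).

Definition spc k : A k := alpha k xs.

Definition coding k (x : bpath) : nat -> A k := fun i => alpha k (iter i adic x).

Definition forward_transitive (x : bpath) :=
  forall k (w : A k), (exists z, alpha k z = w) ->
    exists i, alpha k (iter i adic x) = w.

Definition minimal_to n (v : 'I_(K B n).+1) (y : bpath) :=
  src (y n) = v /\ forall m, m < n -> is_min (y m).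

(* The index j : 'I_(K B n) ranges over the vertices of level n other than the
   spacer; the corresponding vertex is lift ord_max j, of the same value. *)
Definition block k n (j : 'I_(K B n)) : seq (A k) :=
  let v := lift ord_max j in
  mkseq (fun i => alpha k (iter i adic (the xs (minimal_to v)))) (dim v).

Definition growing := forall M, exists N, forall n, N <= n ->
  forall j : 'I_(K B n), M <= size (block 1 j).

Definition semi_periodic_with k n (U : seq (A k)) (c : nat)
    (t l : 'I_(K B n) -> nat) :=
  [/\ U != [::], head (spc k) U != spc k, last (spc k) U != spc k
    & forall j, [/\ 0 < t j, l j <= c
      & block k j = flatten (nseq (t j) (U ++ nseq c (spc k)))
                      ++ U ++ nseq (l j) (spc k)]].

Definition semi_periodic k n :=
  k <= n /\ exists U c t l, @semi_periodic_with k n U c t l.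

Definition shortest_word k n (U : seq (A k)) :=
  forall U' c t l, @semi_periodic_with k n U' c t l -> size U <= size U'.

Definition sources n (v : 'I_(K B n.+1).+1) : seq 'I_(K B n).+1 :=
  [seq src e | e <- sort (@ele B n) [seq e <- enum (edge B n) | rng e == v]].

(* d = [:: (j_1, a_1); ...; (j_m, a_m)] lists the indices and the exponents of
   the explicit decomposition of the blocks at v(n + 1, i). *)
Definition explicit_decomposition n (i : 'I_(K B n.+1))
    (d : seq ('I_(K B n) * nat)) :=
  sources (lift ord_max i) =
    flatten [seq lift ord_max p.1 :: nseq p.2 ord_max | p <- d].

(* The shortest word U determines c, t and l, and a list of sources has at most
   one explicit decomposition. Its last term (j_m, a_m) is split off here. *)
Definition LDC n k :=
  semi_periodic k n /\
  exists U c t l,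
    [/\ @semi_periodic_with k n U c t l, shortest_word n U
      & forall i : 'I_(K B n.+1), exists d j a,
          [/\ explicit_decomposition i (rcons d (j, a)),
              forall p, p \in d -> p.2 = c - l p.1
            & a <= c - l j]].

End Diagram.

Definition periodic (T : Type) (w : nat -> T) :=
  exists P : seq T, P <> [::] /\ forall i, w i = nth (w 0) P (i %% size P).

(* adicP, adic_max, xs_maximal and the_minimal_toP show that the default value
   of the operator [the] is used only for adic at maximal paths. *)
Section WellDefined.
Variable B : bratteli.

Lemma ele_total n (e f : edge B n) : rng e = rng f -> ele e f || ele f e.
Proof. by move=> h; rewrite ele_comparable h eqxx. Qed.

Lemma ele_rng n (e f : edge B n) : ele e f -> rng e = rng f.
Proof. by move=> h; apply/eqP; rewrite -ele_comparable h. Qed.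

Lemma least_edge n (P : pred (edge B n)) v :
  (exists e, P e) -> (forall e, P e -> rng e = v) ->
  exists2 e, P e & forall f, P f -> ele e f.
Proof.
move=> [e0 Pe0] Pv.
have: has P (enum (edge B n)) by apply/hasP; exists e0; rewrite ?mem_enum.
suff H s : has P s -> exists2 e, P e & forall f, f \in s -> P f -> ele e f.
  by move=> /H[e Pe He]; exists e => // f Pf; apply: He; rewrite ?mem_enum.
elim: s => //= a s IHs.
case: (boolP (has P s)) => [/IHs[e Pe He] _ | nPs]; last first.
  rewrite orbF => Pa; exists a => // f; rewrite inE => /orP[/eqP-> _|fs Pf].
    exact: ele_refl.
  by case/hasP: nPs; exists f.
case: (boolP (P a)) => [Pa|nPa]; last first.
  by exists e => // f; rewrite inE => /orP[/eqP->|/He//]; rewrite (negPf nPa).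
have /orP[ea|ae] := ele_total (etrans (Pv e Pe) (esym (Pv a Pa))).
  by exists e => // f; rewrite inE => /orP[/eqP->|/He].
exists a => // f; rewrite inE => /orP[/eqP-> _|fs Pf]; first exact: ele_refl.
exact: ele_trans ae (He f fs Pf).
Qed.

Lemma min_edge n (v : 'I_(K B n.+1).+1) : exists2 e : edge B n, rng e = v & is_min e.
Proof.
have [|e /eqP|e /eqP ev He] := @least_edge n (fun e => rng e == v) v => //.
  exact: rng_surj.
by exists e => //; apply/forallP => f; apply/implyP => /eqP fe; apply: He; rewrite fe ev.
Qed.

Lemma succ_edge n (e : edge B n) : ~~ is_max e -> exists f, is_succ e f.
Proof.
move=> /forallPn[g]; rewrite negb_imply => /andP[/eqP ge nge].
have eg : ele e g by have := ele_total ge; rewrite (negPf nge).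
have neg : e != g by apply: contraNneq nge => <-; apply: ele_refl.
have [|f /andP[/ele_rng//]|f /andP[ef nf] Hf] :=
  @least_edge n (fun f => ele e f && (e != f)) (rng e).
  by exists g; rewrite eg neg.
by exists f; rewrite /is_succ ef nf; apply/forallP => h; apply/implyP/Hf.
Qed.

Lemma succ_uniq n (e f g : edge B n) : is_succ e f -> is_succ e g -> f = g.
Proof.
move=> /and3P[ef nf /forallP Hf] /and3P[eg ng /forallP Hg].
apply: (@ele_anti B n); have := Hf g; have := Hg f.
by rewrite ef nf eg ng /= => -> ->.
Qed.

Lemma min_uniq n (e f : edge B n) : is_min e -> is_min f -> rng e = rng f -> e = f.
Proof.
move=> /forallP He /forallP Hf ef; apply: (@ele_anti B n).
by have := He f; have := Hf e; rewrite ef eqxx /= => -> ->.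
Qed.

Lemma bpath_ext (x y : bpath B) : (forall n, x n = y n) -> x = y.
Proof.
case: x y => [x xP] [y yP] /= xy.
have {}xy : x = y by apply: functional_extensionality_dep.
by case: _ / xy in yP *; congr BPath; apply: Prop_irrelevance.
Qed.

Lemma minimal_completion m (x : forall n, edge B n) :
  (forall n, m <= n -> rng (x n) = src (x n.+1)) ->
  exists y : bpath B, (forall n, m <= n -> y n = x n) /\ forall n, n < m -> is_min (y n).
Proof.
elim: m x => [|m IHm] x xP.
  by exists (@BPath B x (fun n => xP n isT)).
have [e ev emin] := min_edge (src (x m.+1)).
have [n|y [yx ymin]] := IHm (dfwith x e).
  rewrite leq_eqVlt => /orP[/eqP <-|mn].
    by rewrite dfwith_in dfwith_out // neq_ltn ltnSn.
  by rewrite !dfwith_out ?xP // neq_ltn ?mn // ltnS ltnW.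
exists y; split=> n mn.
  by rewrite yx ?dfwith_out // ?neq_ltn ?mn // ltnW.
move: mn; rewrite ltnS leq_eqVlt => /orP[/eqP->|]; last exact: ymin.
by rewrite yx // dfwith_in.
Qed.

Lemma adic_step_ex (x : bpath B) : ~ maximal x -> exists y, adic_step x y.
Proof.
move=> /existsNP xN; have {}xN : exists i, ~~ is_max (x i).
  by case: xN => i /negP; exists i.
case: (ex_minnP xN) => i xi Hi; have [f xf] := succ_edge xi.
have [n|y [yx ymin]] := @minimal_completion i (dfwith x f).
  rewrite leq_eqVlt => /orP[/eqP <-|mn].
    rewrite dfwith_in dfwith_out // ?neq_ltn ?ltnSn // -bpP.
    by case/and3P: xf => /ele_rng.
  by rewrite !dfwith_out ?bpP // neq_ltn ?mn // ltnS ltnW.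
exists y, i; split=> // [m mi||m mi].
- by apply: contraTT mi => /Hi; rewrite -leqNgt.
- by rewrite yx // dfwith_in.
by rewrite yx ?dfwith_out ?neq_ltn ?mi // ltnW.
Qed.

Lemma minimal_to_uniq n (v : 'I_(K B n).+1) (y z : bpath B) :
  minimal_to v y -> minimal_to v z -> forall m, m < n -> y m = z m.
Proof.
elim: n v => // n IHn v [yv ymin] [zv zmin].
have yzn : y n = z n by apply: min_uniq; rewrite ?bpP ?yv ?zv //; auto.
move=> m; rewrite ltnS leq_eqVlt => /orP[/eqP->//|].
by apply: (IHn (src (y n))); split; rewrite ?yzn // => p /ltnW; auto.
Qed.

Lemma adic_step_uniq (x y z : bpath B) : adic_step x y -> adic_step x z -> y = z.
Proof.
move=> [i [xi [nxi yi] ymin yx]] [j [xj [nxj zj] zmin zx]].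
have ij : i = j.
  by case: (ltngtP i j) => // h; [move: nxi; rewrite xj|move: nxj; rewrite xi].
case: _ / ij in xj nxj zj zmin zx *.
have yzi := succ_uniq yi zj.
apply: bpath_ext => n; case: (ltngtP n i) => [ni|ni|->//].
  by apply: (@minimal_to_uniq i (src (y i))) ni; split; rewrite ?yzi.
by rewrite yx ?zx.
Qed.

Lemma adicP (x : bpath B) : ~ maximal x -> adic_step x (adic x).
Proof.
move=> /adic_step_ex h; rewrite /adic /the; case: pselect => // h'.
by case: (cid h').
Qed.

Lemma adic_max (x : bpath B) : maximal x -> adic x = x.
Proof.
move=> xmax; rewrite /adic /the; case: pselect => // h'.
by have [y [i [_ []]]] := h'; rewrite xmax.
Qed.

Lemma xs_maximal : maximal (xs B).
Proof.
move=> n; apply/forallP => f; apply/implyP; rewrite rng_spacer_edge => /eqP fm.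
by rewrite (spacer_uniq fm (rng_spacer_edge B n)) ele_refl.
Qed.

Lemma minimal_to_ex n (v : 'I_(K B n).+1) : exists y, minimal_to v y.
Proof.
pose out i (u : 'I_(K B i).+1) : edge B i := xchoose (src_surj u).
have outP i (u : 'I_(K B i).+1) : src (out i u) = u by apply/eqP; apply: (xchooseP (src_surj u)).
pose f := dfwith (fun i => ord_max : 'I_(K B i).+1) v.
pose H := fix H i : 'I_(K B i).+1 := match i return 'I_(K B i).+1 with
  | 0 => f 0 | i'.+1 => if i' < n then f i'.+1 else rng (out i' (H i')) end.
have [i ni|y [yx ymin]] := @minimal_completion n (fun i => out i (H i)).
  by rewrite outP /= ltnNge ni.
exists y; split=> //; rewrite yx // outP.
have HE i : i <= n -> H i = f i by case: i => //= i ->.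
by rewrite HE // /f dfwith_in.
Qed.

Lemma the_minimal_toP n (v : 'I_(K B n).+1) : minimal_to v (the (xs B) (minimal_to v)).
Proof.
have h := minimal_to_ex v; rewrite /the; case: pselect => // h'.
by case: (cid h').
Qed.

End WellDefined.

(* Main.v *)
(* Let w be the 1-coding of x.

   If w is periodic with least period p, write its first p letters as U s^c,
   with U not ending in the spacer symbol s. Every occurrence in w of a word that
   begins with p letters of w from position 0 is at a multiple of p. By
   compactness and uniqueness of x, all the minimal segments to the non-spacer
   vertices of a high level begin like x, so the blocks of that level occur in w
   only at multiples of p. The gap s^a after an occurrence of a block ends at such
   a multiple, hence a <= c and the block is (U s^c)^t U s^(c - a); moreover a is
   determined by the length of the block modulo p. This is the local deficit
   condition, and no shorter word can be used in place of U.

   Conversely, under LDC(n) the pair (U_n, c_n) also serves at level n + 1. So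
   the length of U_n is nonincreasing, hence eventually constant, after which
   U_n and c_n are constant and w = (U s^c)^oo. *)
Require Import Defs.
From mathcomp Require Import all_boot.
From mathcomp Require Import boolp zify.

Set Implicit Arguments.
Unset Strict Implicit.
Unset Printing Implicit Defensive.

(** * Towers of the adic transformation *)

Section Dynamics.
Variable B : bratteli.
Implicit Types (n k i m : nat) (y z : bpath B).

Lemma succ_not_max n (e f : edge B n) : is_succ e f -> ~~ is_max e.
Proof.
case/and3P=> ef ne _; apply/negP => /forallP/(_ f).
rewrite -(ele_rng ef) eqxx /= => fe; case/eqP: ne.
by apply: (@ele_anti B n); rewrite ef.
Qed.

(** An edge with a successor is not maximal, so the first non-maximal edge of [y] is the [n]-th. *)
Lemma adic_carry n y (f : edge B n) :
    (forall m, m < n -> is_max (y m)) -> is_succ (y n) f ->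
  [/\ forall m, m < n -> is_min (adic y m), adic y n = f
    & forall m, n < m -> adic y m = y m].
Proof.
move=> ymax yf; have nm := succ_not_max yf.
have [|i [yi [nyi si] mini taili]] := @adicP B y; first by move/(_ n); rewrite (negPf nm).
have ni : i = n.
  by case: (ltngtP i n) => // h; [rewrite ymax in nyi | rewrite yi in nm].
by subst i; split=> //; apply: succ_uniq yf.
Qed.

Lemma eq_prefix_of k y z :
  prefix_of k y = prefix_of k z <-> forall m, m < k -> y m = z m.
Proof.
elim: k => [|k IHk] /=; first by split.
split=> [[/IHk yz yzk] m|yz].
  by rewrite ltnS leq_eqVlt => /orP[/eqP->//|/yz].
by congr pair; [apply/IHk => m /ltnW /yz | apply: yz].
Qed.

Lemma eq_alpha k y z : alpha k y = alpha k z <-> forall m, m < k -> y m = z m.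
Proof.
rewrite -eq_prefix_of; split=> [/(congr1 val)//|yz].
exact/val_inj.
Qed.

Lemma dim_gt0 n (v : 'I_(K B n).+1) : 0 < dim v.
Proof.
have [y [yv _]] := minimal_to_ex v.
by apply/card_gt0P; exists (prefix_of n y); rewrite inE -yv prefix_ofP.
Qed.

(** * Incoming edges in increasing order *)

Definition edges_to n (v : 'I_(K B n.+1).+1) : seq (edge B n) :=
  sort (@ele B n) [seq e <- enum (edge B n) | rng e == v].

Lemma mem_edges_to n (v : 'I_(K B n.+1).+1) e : (e \in edges_to v) = (rng e == v).
Proof. by rewrite mem_sort mem_filter mem_enum andbT. Qed.

Lemma dimS n (v : 'I_(K B n.+1).+1) :
  dim v = sumn [seq dim (src e) | e <- edges_to v].
Proof.
rewrite sumnE big_map /edges_to (perm_big _ (permEl (perm_sort _ _))) /=.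
rewrite big_filter big_enum_cond /= /dim -sum1_card.
under [RHS]eq_bigr do rewrite -sum1_card.
rewrite (exchange_big_dep predT) //= pair_big_dep /=.
by apply: eq_bigl => -[s e]; rewrite !inE /= andbC.
Qed.

(** Invariant of the tails of [edges_to v]: upward closure makes each edge the successor of the one
    before it and the last edge maximal. *)
Definition up_list n (e : edge B n) es :=
  [/\ path (@ele B n) e es, uniq (e :: es) & forall g, ele e g -> g \in e :: es].

Lemma edges_to_up_list n (v : 'I_(K B n.+1).+1) :
  exists e es, [/\ edges_to v = e :: es, is_min e & up_list e es].
Proof.
have srt : sorted (@ele B n) (edges_to v).
  apply: (@sort_sorted_in _ [pred e | rng e == v]).
    by move=> e f /eqP ev /eqP fv; apply: ele_total; rewrite ev fv.
  by apply/allP => e; rewrite mem_filter => /andP[].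
have unq : uniq (edges_to v) by rewrite sort_uniq filter_uniq ?enum_uniq.
have := @mem_edges_to n v.
case: (edges_to v) srt unq => [|e es] /= srt unq mem.
  by have [e ev] := rng_surj v; have := mem e; rewrite ev.
have ev : rng e = v by apply/eqP; rewrite -mem mem_head.
exists e, es; split=> //.
  apply/forallP => f; apply/implyP; rewrite ev -mem inE => /orP[/eqP->|].
    exact: ele_refl.
  by move/allP: (order_path_min (@ele_trans B n) srt); apply.
by split=> // g /ele_rng eg; rewrite mem -eg ev.
Qed.

Lemma up_list_cons n (e f : edge B n) es :
  up_list e (f :: es) -> is_succ e f /\ up_list f es.
Proof.
move=> [/= /andP[ef srt] /andP[nef unq] up].
have nef' : e != f by move: nef; rewrite inE negb_or => /andP[].
have mem g : ele e g -> e != g -> g \in f :: es.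
  by move=> /up; rewrite inE eq_sym => /orP[->|].
split.
  rewrite /is_succ ef nef' /=; apply/forallP => g; apply/implyP => /andP[eg ng].
  move: (mem g eg ng); rewrite inE => /orP[/eqP->|]; first exact: ele_refl.
  by move/allP: (order_path_min (@ele_trans B n) srt); apply.
split=> // g fg; apply: mem; first exact: ele_trans ef fg.
apply: contraNneq nef' => eg; apply/eqP/(@ele_anti B n).
by rewrite ef eg fg.
Qed.

Lemma up_list1 n (e : edge B n) : up_list e [::] -> is_max e.
Proof.
move=> [_ _ up]; apply/forallP => f; apply/implyP => /eqP fe.
case/orP: (ele_total fe) => // /up; rewrite inE => /eqP->; exact: ele_refl.
Qed.

(* During [dim v] steps, a path that starts minimally to [v] at level [n] runs
   through the segments to [v], in an order that depends only on [v]. *)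
Definition tower n := forall (v : 'I_(K B n).+1) y z,
  minimal_to v y -> minimal_to v z -> forall i, i < dim v ->
  [/\ forall m, n <= m -> iter i (@adic B) y m = y m,
      forall m, m < n -> iter i (@adic B) y m = iter i (@adic B) z m
    & i.+1 = dim v -> forall m, m < n -> is_max (iter i (@adic B) y m)].

(** One step before time [dim (src e)] all edges below level [n] are maximal, so the next step
    carries into position [n]. *)
Lemma tower_carry n (e f : edge B n) es y : tower n ->
    up_list e (f :: es) -> (forall m, m < n -> is_min (y m)) -> y n = e ->
  let y' := iter (dim (src e)) (@adic B) y in
  [/\ forall m, m < n -> is_min (y' m), y' n = f & forall m, n < m -> y' m = y m].
Proof.
move=> tow /up_list_cons[ef _] ymin yn /=.
have ye : minimal_to (src e) y by rewrite /minimal_to yn.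
have d0 := dim_gt0 (src e).
have [|tail _ ymax] := tow _ y y ye ye (dim (src e)).-1; first by rewrite prednK.
have [||m1 mn m2] := @adic_carry n (iter (dim (src e)).-1 (@adic B) y) f.
- by apply: ymax; rewrite prednK.
- by rewrite tail ?yn.
rewrite -[dim (src e)]prednK //; split=> // m nm; rewrite iterS m2 // tail //.
exact: ltnW.
Qed.

(** A tower one level up is the stack of the towers over the sources; the induction runs over the
    edges still to be used. *)
Lemma towerS_aux n : tower n -> forall es (e : edge B n) y z,
    up_list e es -> (forall m, m < n -> is_min (y m)) ->
    (forall m, m < n -> is_min (z m)) -> y n = e -> z n = e ->
  forall i, i < sumn [seq dim (src f) | f <- e :: es] ->
  [/\ forall m, n < m -> iter i (@adic B) y m = y m,
      forall m, m <= n -> iter i (@adic B) y m = iter i (@adic B) z m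
    & i.+1 = sumn [seq dim (src f) | f <- e :: es] ->
      forall m, m <= n -> is_max (iter i (@adic B) y m)].
Proof.
move=> tow; elim=> [|f es IHes] e y z up ymin zmin yn zn i /=.
  have ye : minimal_to (src e) y by rewrite /minimal_to yn.
  have ze : minimal_to (src e) z by rewrite /minimal_to zn.
  rewrite addn0 => ilt; have [t a mx] := tow _ y z ye ze i ilt.
  have [tz _ _] := tow _ z y ze ye i ilt.
  split=> [m nm|m|iE m].
  - exact/t/ltnW.
  - by rewrite leq_eqVlt => /orP[/eqP->|/a//]; rewrite t // tz // yn zn.
  - rewrite leq_eqVlt => /orP[/eqP->|]; last exact: mx.
    by rewrite t // yn up_list1.
have ye : minimal_to (src e) y by rewrite /minimal_to yn.
have ze : minimal_to (src e) z by rewrite /minimal_to zn.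
have [ymin' yn' yt'] := tower_carry tow up ymin yn.
have [zmin' zn' zt'] := tower_carry tow up zmin zn.
have [ef up'] := up_list_cons up.
case: (ltnP i (dim (src e))) => [ilt _|ige ilt].
  have [t a mx] := tow _ y z ye ze i ilt.
  have [tz _ _] := tow _ z y ze ye i ilt.
  split=> [m nm|m|iE].
  - exact/t/ltnW.
  - by rewrite leq_eqVlt => /orP[/eqP->|/a//]; rewrite t // tz // yn zn.
  - by have := dim_gt0 (src f); lia.
have [|t a mx] := IHes f _ _ up' ymin' zmin' yn' zn' (i - dim (src e)).
  by rewrite /=; lia.
rewrite -!iterD subnK // in t a mx.
split=> [m nm|//|iE]; first by rewrite t ?yt'.
by apply: mx; rewrite /=; lia.
Qed.

Lemma dim0 (v : 'I_(K B 0).+1) : dim v = 1.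
Proof. by rewrite -[RHS]card_unit; apply: eq_card => s; rewrite inE. Qed.

Lemma towerP n : tower n.
Proof.
elim: n => [|n IHn] v y z [yv ymin] [zv zmin] i.
  by rewrite dim0; case: i.
have [e [es [vE emin up]]] := edges_to_up_list v.
have ev : rng e = v by apply/eqP; rewrite -mem_edges_to vE mem_head.
have yn : y n = e by apply: min_uniq; rewrite ?ymin // bpP yv ev.
have zn : z n = e by apply: min_uniq; rewrite ?zmin // bpP zv ev.
rewrite dimS vE => /(towerS_aux IHn up _ _ yn zn)[||t a mx].
- by move=> m mn; apply: ymin; apply: ltnW.
- by move=> m mn; apply: zmin; apply: ltnW.
by split.
Qed.

(** Extends [block] to the spacer vertex, so that concatenation over sources needs no case
    distinction. *)
Definition word k n (v : 'I_(K B n).+1) : seq (A B k) :=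
  mkseq (fun i => alpha k (iter i (@adic B) (the (xs B) (minimal_to v)))) (dim v).

Lemma blockE k n (j : 'I_(K B n)) : block k j = word k (lift ord_max j).
Proof. by []. Qed.

Lemma size_word k n (v : 'I_(K B n).+1) : size (word k v) = dim v.
Proof. exact: size_mkseq. Qed.

(** By [towerP] the segments met do not depend on the minimal path; [k <= n] keeps the first [k]
    edges inside the tower. *)
Lemma wordE k n (v : 'I_(K B n).+1) y : k <= n -> minimal_to v y ->
  word k v = mkseq (fun i => alpha k (iter i (@adic B) y)) (dim v).
Proof.
move=> kn yv; apply: (@eq_from_nth _ (spc B k)); rewrite ?size_mkseq // => i ilt.
rewrite !nth_mkseq //; apply/eq_alpha => m mk.
have [_ + _] := towerP (the_minimal_toP v) yv ilt; apply; exact: leq_trans mk kn.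
Qed.

Lemma nth_word k n (v : 'I_(K B n).+1) y i : k <= n -> minimal_to v y -> i < dim v ->
  nth (spc B k) (word k v) i = coding k y i.
Proof. by move=> kn yv ilt; rewrite (wordE kn yv) nth_mkseq. Qed.

Lemma wordS k n (v : 'I_(K B n.+1).+1) : k <= n ->
  word k v = flatten [seq word k u | u <- sources v].
Proof.
move=> kn; have [e [es [vE emin up]]] := edges_to_up_list v.
have yv := the_minimal_toP v; move: (the _ _) yv => y yv.
rewrite (wordE (leqW kn) yv) dimS /sources -/(edges_to v) vE -map_comp.
have ev : rng e = v by apply/eqP; rewrite -mem_edges_to vE mem_head.
case: yv => yv ymin.
have yn : y n = e by apply: min_uniq; rewrite ?ymin // bpP yv ev.
have {}ymin m : m < n -> is_min (y m) by move=> mn; apply: ymin; apply: ltnW.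
(* The claim is generalised to any tail of the edge list, entered at its first edge [e]. *)
elim: es e y up yn ymin {emin vE yv ev} => [|f es IHes] e y up yn ymin /=.
  by rewrite addn0 cats0 (@wordE k n (src e) y) //; split; rewrite ?yn.
have [ymin' yn' _] := tower_carry (@towerP n) up ymin yn.
have [_ up'] := up_list_cons up.
have /= <- := IHes f _ up' yn' ymin'.
rewrite (@wordE k n (src e) y) //; last by split; rewrite ?yn.
rewrite /mkseq iotaD map_cat; congr cat.
rewrite -[0 + _]addn0 iotaDl -map_comp; apply: eq_map => i /=.
by rewrite -iterD addnC.
Qed.

Lemma edges_to_spacer n : edges_to (ord_max : 'I_(K B n.+1).+1) = [:: spacer_edge B n].
Proof.
have [e [es [vE _ [_ unq _]]]] := edges_to_up_list (ord_max : 'I_(K B n.+1).+1).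
have mem f : f \in e :: es -> f = spacer_edge B n.
  by rewrite -vE mem_edges_to => /eqP fm; apply: spacer_uniq fm (rng_spacer_edge B n).
rewrite vE; case: es {vE} unq mem => [|f es] unq mem; first by rewrite (mem e) ?mem_head.
move: unq; rewrite /= inE (mem e) ?mem_head // (mem f) ?eqxx //.
by rewrite !inE eqxx orbT.
Qed.

Lemma src_xs n : src (xs B n) = ord_max.
Proof. exact/spacer_src/rng_spacer_edge. Qed.

Lemma minimal_to_xs n : minimal_to ord_max (xs B) (n := n).
Proof.
split=> [|m mn]; first exact: src_xs.
apply/forallP => f; apply/implyP => /eqP fm.
by rewrite (@spacer_uniq B m f (xs B m)) ?ele_refl // ?fm rng_spacer_edge.
Qed.

Lemma dim_spacer n : dim (ord_max : 'I_(K B n).+1) = 1.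
Proof.
elim: n => [|n IHn]; first exact: dim0.
by rewrite dimS edges_to_spacer /= src_xs IHn.
Qed.

Lemma word_spacer k n : k <= n -> word k (ord_max : 'I_(K B n).+1) = [:: spc B k].
Proof. by move=> kn; rewrite (wordE kn (minimal_to_xs n)) dim_spacer. Qed.

End Dynamics.

(** * Semi-periodic words and periodic sequences *)

Section Words.
Variables (T : eqType) (s : T).
Implicit Types (U W : seq T) (w : nat -> T) (c t l p q i : nat).

Definition semi U c t l := flatten (nseq t (U ++ nseq c s)) ++ U ++ nseq l s.

Lemma size_semi U c t l : size (semi U c t l) = t * (size U + c) + (size U + l).
Proof.
rewrite /semi size_cat size_flatten /shape map_nseq sumn_nseq !size_cat !size_nseq.
by rewrite mulnC.
Qed.

Lemma nth_semi U c t l i : l <= c -> i < size (semi U c t l) ->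
  nth s (semi U c t l) i = nth s (U ++ nseq c s) (i %% (size U + c)).
Proof.
move=> lc; rewrite size_semi /semi; elim: t i => [|t IHt] i /=.
  rewrite mul0n add0n => ilt; rewrite modn_small; last by lia.
  by rewrite !nth_cat !nth_nseq !if_same.
move=> ilt; rewrite -catA nth_cat size_cat size_nseq.
case: ltnP => [ilt'|ige]; first by rewrite modn_small.
rewrite IHt; last by move: ilt; rewrite mulSn; lia.
by rewrite -{2}(subnK ige) modnDr.
Qed.

(** The arithmetic of the local deficit condition: [c - l] further spacers complete the last
    period. *)
Lemma semi_cat U c t l : l <= c ->
  semi U c t l ++ nseq (c - l) s = flatten (nseq t.+1 (U ++ nseq c s)).
Proof.
move=> lc; rewrite /semi -!catA -nseqD subnKC // -addn1 nseqD flatten_cat /=.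
by rewrite cats0.
Qed.

Lemma split_trailing W : exists U c, W = U ++ nseq c s /\ (U = [::] \/ last s U != s).
Proof.
elim/last_ind: W => [|W a [U [c [-> HU]]]]; first by exists [::], 0; split=> //; left.
have [->|nas] := eqVneq a s.
  exists U, c.+1; split=> //; rewrite -cats1 -catA; congr cat.
  by rewrite -addn1 nseqD.
exists (rcons (U ++ nseq c s) a), 0; rewrite cats0; split=> //; right.
by rewrite last_rcons.
Qed.

(** [U] is the prefix of known length. If [c < c'], position [size U + c] holds the head of [U] in
    one reading and [s] in the other; [0 < t] puts it inside the word. *)
Lemma semi_inj U U' c c' t t' l l' :
    head s U != s -> head s U' != s -> l <= c -> l' <= c' -> 0 < t -> 0 < t' ->
    size U = size U' -> semi U c t l = semi U' c' t' l' -> U = U' /\ c = c'.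
Proof.
move=> hU hU' lc lc' t0 t0' sU E.
have UU : U = U'.
  have take_semi V b r m : 0 < r -> take (size V) (semi V b r m) = V.
    by case: r => // r _; rewrite /semi /= -!catA take_size_cat.
  by rewrite -(take_semi U c t l) // E sU take_semi.
split=> //; rewrite -UU {UU U' hU' sU} in E hU' *.
wlog cc : c c' t t' l l' lc lc' t0 t0' E / c < c'.
  move=> H; case: (ltngtP c c') => // h; first exact: (H _ _ t t' l l').
  by apply/esym; apply: (H _ _ t' t l' l).
have U0 : 0 < size U by case: (U) hU; rewrite //= eqxx.
have lt1 : size U + c < size (semi U c t l).
  by rewrite size_semi; case: (t) t0 => // r _; rewrite mulSn; lia.
have := nth_semi lc lt1; rewrite modnn nth_cat U0 nth0 => nh.
case/eqP: hU; rewrite -nh E nth_semi -?E //.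
rewrite modn_small ?ltn_add2l // nth_cat ltnNge leq_addr /=.
by rewrite nth_nseq if_same.
Qed.

(** * Periods and occurrences *)

Definition period w p := forall i, w (i + p) = w i.

Lemma periodM w p k i : period w p -> w (i + k * p) = w i.
Proof. by move=> wp; elim: k => [|k IHk]; rewrite ?addn0 // mulSnr addnA wp. Qed.

Lemma period_mod w p i : period w p -> w (i %% p) = w i.
Proof. by move=> wp; rewrite {2}(divn_eq i p) addnC periodM. Qed.

(** The period [p] spreads agreement on one window of [p] letters to all positions. *)
Lemma period_window w p q : 0 < p -> period w p ->
  (forall i, i < p -> w (q + i) = w i) -> period w q.
Proof.
move=> p0 wp wq i; rewrite -(period_mod i wp) -(wq (i %% p)) ?ltn_mod //.
by rewrite -(period_mod (i + q) wp) -(period_mod (q + _) wp) modnDmr addnC.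
Qed.

Lemma least_period w : periodic w ->
  exists p, [/\ 0 < p, period w p & forall q, period w q -> p %| q].
Proof.
move=> [P [P0 wP]].
have ex : exists p, (0 < p) && `[<period w p>].
  exists (size P); apply/andP; split; first by case: (P) P0.
  by apply/asboolP => i; rewrite wP modnDr -wP.
case: (ex_minnP ex) => p /andP[p0 /asboolP wp] pmin; exists p; split=> // q wq.
rewrite /dvdn; apply: contraT; rewrite -lt0n => r0.
have /pmin : (0 < q %% p) && `[<period w (q %% p)>].
  rewrite r0; apply/asboolP => i; rewrite -(periodM (q %/ p) _ wp) -addnA.
  by rewrite (addnC (q %% p)) -divn_eq wq.
by rewrite leqNgt ltn_mod p0.
Qed.

Definition occurs w W q := forall i, i < size W -> w (q + i) = nth s W i.

Lemma occurs_cat w W1 W2 q :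
  occurs w (W1 ++ W2) q <-> occurs w W1 q /\ occurs w W2 (q + size W1).
Proof.
split=> [occ|[o1 o2] i].
  split=> i ilt; first by rewrite occ ?nth_cat ?ilt // size_cat ltn_addr.
  rewrite -addnA occ ?size_cat ?ltn_add2l // nth_cat ltnNge leq_addr /=.
  by rewrite addKn.
rewrite size_cat nth_cat; case: (ltnP i (size W1)) => [ilt _|ige ilt]; first exact: o1.
by rewrite -o2 ?ltn_subLR // -addnA subnKC.
Qed.

Lemma occurs_nseq w a q :
  occurs w (nseq a s) q <-> forall i, i < a -> w (q + i) = s.
Proof.
split=> occ i ilt; first by rewrite occ ?size_nseq // nth_nseq if_same.
by rewrite nth_nseq if_same occ // -(size_nseq a s).
Qed.

(** * A periodic sequence cut at the multiples of its least period *)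

Section Periodic.
Variables (w : nat -> T) (p : nat) (U : seq T) (c : nat).
Hypotheses (p_gt0 : 0 < p) (w_period : period w p).
Hypothesis w_least : forall q, period w q -> p %| q.
Hypothesis wUc : mkseq w p = U ++ nseq c s.
Hypothesis lastU : last s U != s.

Lemma size_Uc : size U + c = p.
Proof. by rewrite -(size_nseq c s) -size_cat -wUc size_mkseq. Qed.

Lemma U_gt0 : 0 < size U.
Proof. by case: (U) lastU; rewrite //= eqxx. Qed.

Lemma trailing_lt : c < p.
Proof. by rewrite -size_Uc -{1}[c]add0n ltn_add2r U_gt0. Qed.

Lemma w_nth i : w i = nth s (U ++ nseq c s) (i %% p).
Proof. by rewrite -wUc nth_mkseq ?ltn_mod // period_mod. Qed.

Lemma w_before Q b : 0 < Q -> p %| Q -> b < p ->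
  w (Q - b.+1) = nth s (U ++ nseq c s) (p - b.+1).
Proof.
move=> Q0 /dvdnP[[|r] QE] bp; first by rewrite QE in Q0.
rewrite QE mulSn -addnBAC // addnC w_nth modnMDl modn_small //; lia.
Qed.

(** With [w_last]: the run of [s] ending just before a positive multiple of [p] has length exactly
    [c]. The offset [b.+1] counts back from that multiple. *)
Lemma w_trailing Q b : 0 < Q -> p %| Q -> b < c -> w (Q - b.+1) = s.
Proof.
move=> Q0 pQ bc; have cp := trailing_lt; rewrite w_before //; last by lia.
by rewrite nth_cat nth_nseq if_same; case: ltnP => //; have := size_Uc; lia.
Qed.

Lemma w_last Q : 0 < Q -> p %| Q -> w (Q - c.+1) != s.
Proof.
move=> Q0 pQ; have cp := trailing_lt; rewrite w_before //.
have -> : p - c.+1 = (size U).-1 by have := size_Uc; lia.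
by rewrite nth_cat prednK ?U_gt0 // leqnn nth_last.
Qed.

(** A longer gap would cover the last letter of [U] in the period that ends there. *)
Lemma gap_le W q a : 0 < size W -> p %| q + size W + a ->
  occurs w (W ++ nseq a s) q -> a <= c.
Proof.
move=> W0 pQ /occurs_cat[_ /occurs_nseq occ]; rewrite leqNgt; apply/negP => ca.
have Q0 : 0 < q + size W + a by lia.
have /eqP[] := w_last Q0 pQ.
have -> : q + size W + a - c.+1 = q + size W + (a - c.+1) by lia.
by apply: occ; lia.
Qed.

(** [W] starts with a period and stops [a] letters before the end of the [r]-th one, which is thus
    cut to [U] and [c - a] spacers; [p < size W] forces [r > 1]. *)
Lemma gap_word W q a : p < size W -> p %| q -> p %| q + size W + a ->
  occurs w (W ++ nseq a s) q ->
  exists2 t, 0 < t & W = semi U c t (c - a).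
Proof.
move=> pW pq pQ occ; have ac : a <= c by apply: gap_le pQ occ; lia.
have [occW _] := (occurs_cat w W (nseq a s) q).1 occ.
move: (pQ); rewrite -addnA dvdn_addr // => /dvdnP[r rE].
have r1 : 1 < r by rewrite -(ltn_pmul2r p_gt0); lia.
exists r.-1; first by lia.
have sz : size W = size (semi U c r.-1 (c - a)).
  rewrite size_semi size_Uc; case: (r) r1 rE => // r' _; rewrite mulSn /=.
  by have := size_Uc; lia.
apply: (@eq_from_nth _ s) => // i ilt; rewrite nth_semi ?leq_subr -?sz //.
by rewrite size_Uc -occW // w_nth -modnDml (eqP pq) add0n.
Qed.

(** Since [c < p], the gap after a block depends only on the length of the block. *)
Lemma gap_uniq n a a' : a <= c -> a' <= c -> p %| n + a -> p %| n + a' -> a = a'.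
Proof.
move=> ac ac' /eqP pa /eqP pa'; have cp := trailing_lt.
have /eqP : n + a = n + a' %[mod p] by rewrite pa pa'.
by rewrite eqn_modDl !modn_small ?(leq_ltn_trans _ cp) // => /eqP.
Qed.

Hypothesis w0 : w 0 != s.

(* A shorter word [U'] would make [size U' + c'] a period of [w], hence a
   multiple of [p], and the runs of [s] would give [c' = c]. *)
Lemma semi_shortest U' c' t l q : p %| q -> 3 * p <= size (semi U' c' t l) ->
    0 < t -> l <= c' -> last s U' != s -> occurs w (semi U' c' t l) q ->
  size U <= size U'.
Proof.
move=> pq pW t0 lc lastU' occ; rewrite leqNgt; apply/negP => UU.
have U0 : 0 < size U' by case: (U') lastU'; rewrite //= eqxx.
have sW := size_semi U' c' t l.
have Vle : size U' + c' <= size (semi U' c' t l).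
  by rewrite sW; case: (t) t0 => // r _; rewrite mulSn; lia.
have wn i : i < size (semi U' c' t l) ->
    w i = nth s (U' ++ nseq c' s) (i %% (size U' + c')).
  move=> ilt; rewrite -(@nth_semi U' c' t l) // -occ // -(period_mod i w_period).
  by rewrite -(period_mod (q + i) w_period) -modnDml (eqP pq).
have cp := size_Uc.
(* Otherwise position [p] would fall in the first run of [s] after [U'], whereas [w p = w 0]. *)
have c'p : c' < p.
  rewrite ltnNge; apply/negP => pc.
  have /eqP[] : w p != s by rewrite -[p]add0n w_period.
  by rewrite wn ?modn_small ?nth_cat ?nth_nseq ?if_same; case: ltnP => //; lia.
set p' := size U' + c' in wn Vle *.
have pp' : p %| p'.
  (* Here [p' < 2 * p], so the window of [p] letters at [p'] fits into the first [3 * p] letters. *)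
  apply/w_least/(period_window p_gt0 w_period) => i ip.
  rewrite !wn ?modnDl //; rewrite /p'; lia.
have p'0 : 0 < p' by rewrite addn_gt0 U0.
have cc : c' = c.
  case: (ltngtP c' c) => // h.
    have := w_trailing p'0 pp' h; rewrite wn ?modn_small; try lia.
    rewrite nth_cat; case: ltnP => [_|]; last by rewrite /p'; lia.
    have -> : p' - c'.+1 = (size U').-1 by rewrite /p'; lia.
    by rewrite nth_last => /eqP; rewrite (negPf lastU').
  have /eqP[] := w_last p'0 pp'; rewrite wn ?modn_small; try lia.
  by rewrite nth_cat nth_nseq if_same; case: ltnP => //; rewrite /p'; lia.
by have := dvdn_leq p'0 pp'; rewrite /p'; lia.
Qed.

End Periodic.
End Words.

(** * Minimal paths and orbits *)

Section Paths.
Variable B : bratteli.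
Implicit Types (n k i m q : nat) (y z : bpath B).

(** Koenig's lemma: [C n z] says that paths in [P m], for arbitrarily large [m], share the first [n]
    edges of [z]. Each level has finitely many edges, so such a segment can be prolonged. *)
Lemma path_compactness (P : nat -> bpath B -> Prop) :
    (forall M, exists m y, M <= m /\ P m y) ->
  exists z, forall n M, exists m y, [/\ M <= m, P m y & forall i, i < n -> y i = z i].
Proof.
move=> infP.
pose C n z := forall M, exists m y, [/\ M <= m, P m y & forall i, i < n -> y i = z i].
have step n z : C n z -> exists z', C n.+1 z' /\ forall i, i < n -> z' i = z i.
  move=> Cz; have [e He] : exists e : edge B n, forall M, exists m y,
      [/\ M <= m, P m y, forall i, i < n -> y i = z i & y n = e].
    apply: contrapT => nex.
    have /choice[f Hf] : forall e : edge B n, exists M, forall m y,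
        M <= m -> P m y -> (forall i, i < n -> y i = z i) -> y n <> e.
      move=> e; apply: contrapT => /forallNP nM; apply: nex; exists e => M.
      have /existsNP[m /existsNP[y]] := nM M.
      move=> /not_implyP[Mm /not_implyP[Pm /not_implyP[yz /contrapT ye]]].
      by exists m, y.
    have [m [y [Mm Pm yz]]] := Cz (\max_e f e).
    by apply: (Hf (y n) m y) => //; apply: leq_trans Mm; apply: leq_bigmax.
  have [_ [z' [_ _ z'z z'e]]] := He 0; exists z'; split=> // M.
  have [m [y [Mm Pm yz ye]]] := He M; exists m, y; split=> // i.
  by rewrite ltnS leq_eqVlt => /orP[/eqP->|ilt]; rewrite ?ye // yz ?z'z.
have /choice[F HF] : forall a : nat * bpath B, exists z', C a.1 a.2 ->
    C a.1.+1 z' /\ forall i, i < a.1 -> z' i = a.2 i.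
  move=> a; case: (pselect (C a.1 a.2)) => [/step[z' ?]|nC]; first by exists z'.
  by exists a.2.
have [_ [y0 _]] := infP 0.
pose Y := fix Y n := if n is n'.+1 then F (n', Y n') else y0.
have CY n : C n (Y n).
  elim: n => [|n IHn] /=; last by have [] := HF (n, Y n) IHn.
  by move=> M; have [m [y [Mm Pm]]] := infP M; exists m, y.
have YS n i : i < n -> Y n.+1 i = Y n i.
  by have [_] := HF (n, Y n) (CY n); apply.
have YE n i : i < n -> Y n i = Y i.+1 i.
  elim: n => // n IHn; rewrite ltnS leq_eqVlt => /orP[/eqP->//|ilt].
  by rewrite YS ?IHn.
(* Diagonal path: edge [n] is final from stage [n.+1] on. *)
pose z n := Y n.+1 n.
have zP n : rng (z n) = src (z n.+1) by rewrite /z -bpP -(YE n.+2).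
exists (BPath zP) => n M; have [m [y [Mm Pm yY]]] := CY n M.
by exists m, y; split=> // i ilt; rewrite yY // YE.
Qed.

(** Transitivity is applied to the cylinder of the minimal segment to [v]; for [0 < n] its last edge
    determines the vertex at level [n]. *)
Lemma minimal_to_exists_iter n (v : 'I_(K B n).+1) x : 0 < n ->
  forward_transitive x -> exists q, minimal_to v (iter q (@adic B) x).
Proof.
move=> n0 xt; have [y [yv ymin]] := minimal_to_ex v.
have [q /eq_alpha xy] := xt n (alpha n y) (ex_intro _ y erefl).
exists q; split=> [|m mn]; last by rewrite xy // ymin.
by case: n n0 v yv xy {ymin} => // n _ v yv xy; rewrite -bpP xy // bpP.
Qed.

Lemma iter_adic_max q y : maximal y -> iter q (@adic B) y = y.
Proof. by move=> ymax; elim: q => //= q ->; apply: adic_max. Qed.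

(** The tower ends with all edges below [n] maximal, so the next step acts at level [n] or above and
    resets the edges below. *)
Lemma minimal_below_dim n y : (forall q, ~ maximal (iter q (@adic B) y)) ->
    (forall m, m < n -> is_min (y m)) ->
  forall m, m < n -> is_min (iter (dim (src (y n))) (@adic B) y m).
Proof.
move=> nmax ymin m mn; have yv : minimal_to (src (y n)) y by [].
have d0 := dim_gt0 (src (y n)).
have [|_ _ ymax] := towerP yv yv (i := (dim (src (y n))).-1); first by rewrite prednK.
rewrite -(prednK d0) iterS.
have [i [_ [nmi _] mini _]] := adicP (nmax (dim (src (y n))).-1).
apply: mini; apply: leq_trans mn _; rewrite leqNgt; apply/negP => ilt.
by case/negP: nmi; apply: ymax; rewrite ?prednK.
Qed.

Lemma codingD k y q i : coding k y (q + i) = coding k (iter q (@adic B) y) i.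
Proof. by rewrite /coding addnC iterD. Qed.

Lemma occurs_word k n (v : 'I_(K B n).+1) y q : k <= n ->
  minimal_to v (iter q (@adic B) y) -> occurs (spc B k) (coding k y) (word k v) q.
Proof.
by move=> kn yv i; rewrite size_word => ilt; rewrite codingD (nth_word kn yv).
Qed.

Lemma nonspacerE n (v : 'I_(K B n).+1) : v <> ord_max -> exists j, v = lift ord_max j.
Proof. by case: (unliftP ord_max v) => [j|] -> // _; exists j. Qed.

Lemma lift_nonspacer n (j : 'I_(K B n)) : lift ord_max j <> ord_max.
Proof. by apply/eqP; rewrite eq_sym; apply: neq_lift. Qed.

Lemma decomposition n (vs : seq 'I_n.+1) :
  exists a d, vs = nseq a ord_max ++
    flatten [seq lift ord_max b.1 :: nseq b.2 ord_max | b : 'I_n * nat <- d].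
Proof.
elim: vs => [|v vs [a [d ->]]]; first by exists 0, [::].
case: (unliftP ord_max v) => [j|] ->; first by exists 0, ((j, a) :: d).
by exists a.+1, d.
Qed.

Lemma block_explicit k n (i : 'I_(K B n.+1)) d : k <= n -> explicit_decomposition i d ->
  block k i = flatten [seq block k b.1 ++ nseq b.2 (spc B k) | b <- d].
Proof.
move=> kn id; rewrite blockE wordS // id.
elim: d {id} => //= -[j a] d IHd; rewrite map_cat flatten_cat IHd catA; congr cat.
rewrite blockE; congr cat; elim: a => //= a ->; by rewrite word_spacer.
Qed.

(** * Minimal edges and spacer vertices *)

Hypothesis hyp_c : forall n, 1 <= n -> forall e : edge B n,
  rng e <> ord_max -> is_min e -> src e <> ord_max.

Lemma nonspacer_below n y : (forall m, m < n -> is_min (y m)) -> src (y n) <> ord_max ->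
  forall m, 0 < m <= n -> src (y m) <> ord_max.
Proof.
elim: n => [|n IHn] ymin yn m /andP[m0]; first by rewrite leqNgt m0.
rewrite leq_eqVlt => /orP[/eqP->//|mn].
apply: IHn => [i ilt||]; rewrite ?m0 //; first exact/ymin/ltnW.
by apply: hyp_c; rewrite ?bpP //; [apply: leq_trans m0 _|apply: ymin].
Qed.

Lemma minimal_alpha1 n y : 0 < n -> (forall m, m < n -> is_min (y m)) ->
  src (y n) <> ord_max -> alpha 1 y <> spc B 1.
Proof.
move=> n0 ymin yn /eq_alpha/(_ 0 isT) y0.
by apply: (@nonspacer_below n y ymin yn 1) => //; rewrite -bpP y0 rng_spacer_edge.
Qed.

(** The first source is that of the minimal edge, so by [hyp_c] there are no leading spacers. *)
Lemma explicit_decomposition_ex n (i : 'I_(K B n.+1)) : 0 < n ->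
  exists d j a, explicit_decomposition i (rcons d (j, a)).
Proof.
move=> n0; have [[|a] [d iE]] := decomposition (sources (lift ord_max i)).
  case/lastP: d iE => [|d [j a]] iE; last by exists d, j, a.
  have [e [es [vE _ _]]] := edges_to_up_list (lift ord_max i).
  by move: iE; rewrite /sources -/(edges_to _) vE.
have [e [es [vE emin _]]] := edges_to_up_list (lift ord_max i).
have ev : rng e = lift ord_max i by apply/eqP; rewrite -mem_edges_to vE mem_head.
move: iE; rewrite /sources -/(edges_to _) vE => -[/hyp_c] [] //.
by rewrite ev; apply: lift_nonspacer.
Qed.

Variable x : bpath B.
Hypothesis x_unique : unique (fun y : bpath B => y <> xs B /\ minimal y) x.

(** [x] leaves the spacer vertices somewhere and cannot return, as they are entered only from each
    other; [nonspacer_below] carries this down to level 1. *)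
Lemma x_nonspacer n : 0 < n -> src (x n) <> ord_max.
Proof.
case: x_unique => -[xxs xmin] _ n0.
have [m xm] : exists m, x m <> xs B m.
  by apply/existsNP => xE; apply/xxs/bpath_ext.
have up r : src (x (m.+1 + r)) <> ord_max.
  elim: r => [|r IHr]; last by rewrite addnS -bpP => /spacer_src.
  by rewrite addn0 -bpP => /spacer_uniq/(_ (rng_spacer_edge B m)).
apply: (@nonspacer_below (m.+1 + n) x _ (up n)) => [i _|]; first exact: xmin.
by rewrite n0 leq_addl.
Qed.

Lemma minimal_to_x n : minimal_to (src (x n)) x.
Proof. by case: x_unique => -[_ xmin] _; split=> // m _; apply: xmin. Qed.

(* Otherwise compactness gives a second minimal path other than [xs]. *)
Lemma minimal_agree n : exists M, forall m y, M <= m ->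
    (forall i, i < m -> is_min (y i)) -> src (y m) <> ord_max ->
  forall i, i < n -> y i = x i.
Proof.
apply: contrapT => /forallNP H.
pose P m y := [/\ forall i, i < m -> is_min (y i), src (y m) <> ord_max
  & exists2 i, i < n & y i <> x i].
have [M|z Hz] := @path_compactness P.
  have /existsNP[m /existsNP[y]] := H M.
  move=> /not_implyP[Mm /not_implyP[ymin /not_implyP[ym /existsNP[i]]]].
  by move=> /not_implyP[ilt yx]; exists m, y; split=> //; split=> //; exists i.
have zmin : minimal z.
  move=> i; have [m [y [Mm [ymin _ _] yz]]] := Hz i.+1 i.+1.
  by rewrite -yz // ymin.
(* The first edge of an approximating path already avoids the spacer vertex of level 1. *)
have zxs : z <> xs B.
  move=> zE; have [m [y [m0 [ymin ym _] yz]]] := Hz 1 1.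
  by apply: (minimal_alpha1 m0 ymin ym); apply/eq_alpha => i /yz ->; rewrite zE.
have [m [y [_ [_ _ [i ilt yx]] yz]]] := Hz n 0.
by case: x_unique => _ /(_ z (conj zxs zmin)) xz; apply: yx; rewrite yz ?xz.
Qed.

End Paths.

(** * Periodicity and the local deficit condition *)

Section Equivalence.
Variable B : bratteli.
Implicit Types (n k i m q : nat).
Hypothesis hyp_a : forall n, 1 <= n -> 1 <= K B n.
Hypothesis hyp_c : forall n, 1 <= n -> forall e : edge B n,
  rng e <> ord_max -> is_min e -> src e <> ord_max.
Hypothesis hyp_d : growing B.
Variable x : bpath B.
Hypothesis x_unique : unique (fun y : bpath B => y <> xs B /\ minimal y) x.

Local Notation s := (spc B 1).
Local Notation w := (coding 1 x).

Lemma dim_growing M : exists2 n, 0 < n &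
  forall m (j : 'I_(K B m)), n <= m -> M <= dim (lift ord_max j).
Proof.
have [N HN] := hyp_d M; exists N.+1 => // m j Nm.
by rewrite -(size_word 1) -blockE HN // ltnW.
Qed.

Lemma coding_block n i : 0 < n ->
  exists2 j : 'I_(K B n), src (x n) = lift ord_max j &
  i < dim (lift ord_max j) -> nth s (block 1 j) i = w i.
Proof.
move=> n0; have [j xj] := nonspacerE (x_nonspacer hyp_c x_unique n0).
by exists j => // ilt; rewrite blockE -xj (nth_word n0 (minimal_to_x x_unique n)) ?xj.
Qed.

(** * From the local deficit condition to periodicity *)

Lemma semi_periodic_next n U c t l : 0 < n ->
    @semi_periodic_with B 1 n U c t l ->
    (forall i : 'I_(K B n.+1), exists d j a,
      [/\ explicit_decomposition i (rcons d (j, a)),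
          forall b, b \in d -> b.2 = c - l b.1 & a <= c - l j]) ->
  exists t' l', @semi_periodic_with B 1 n.+1 U c t' l'.
Proof.
move=> n0 [U0 hU lU HB] Hd.
have /choice[f Hf] : forall i : 'I_(K B n.+1), exists b : nat * nat,
    [/\ 0 < b.1, b.2 <= c & block 1 i = semi s U c b.1 b.2].
  move=> i; have [d [j [a [iE dP ac]]]] := Hd i.
  have [t0 lc jE] := HB j.
  have [r rE] : exists r, flatten [seq block 1 b.1 ++ nseq b.2 s | b <- d]
      = flatten (nseq r (U ++ nseq c s)).
    elim: d dP {iE} => [|b d IHd] dP; first by exists 0.
    have [|r rE] := IHd; first by move=> b' b'd; apply: dP; rewrite inE b'd orbT.
    have [_ lb bE] := HB b.1; exists ((t b.1).+1 + r).
    rewrite nseqD flatten_cat -(@semi_cat _ s U c _ (l b.1)) //=.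
    by rewrite rE bE dP ?mem_head.
  (* The blocks before the last contribute [r] full periods, their gaps being exact; the last gap
     only lengthens the final run of [s], up to at most [c]. *)
  exists (r + t j, l j + a); split=> /=; [by lia | by lia |].
  rewrite (block_explicit n0 iE) map_rcons -cats1 flatten_cat rE /= cats0 jE /semi.
  by rewrite nseqD flatten_cat !nseqD -!catA.
by exists (fst \o f), (snd \o f); split=> // i; apply: Hf.
Qed.

Lemma LDC_periodic N : (forall n, N <= n -> LDC B n 1) -> periodic w.
Proof.
move=> HL.
(* All admissible words at all levels from [N] on compete here, not only the shortest of each
   level. *)
pose P r := exists n U c t l, [/\ N <= n, @semi_periodic_with B 1 n U c t l & size U = r].
have exP : exists r, `[<P r>].
  have [_ [U [c [t [l [sp _ _]]]]]] := HL N (leqnn N).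
  by exists (size U); apply/asboolP; exists N, U, c, t, l.
case: (ex_minnP exP) => r /asboolP[n0 [U [c [t [l [Nn0 sp0 Ur]]]]]] rmin.
have n0_gt0 : 0 < n0 by have [[] ] := HL n0 Nn0.
have sp n : n0 <= n -> exists t l, @semi_periodic_with B 1 n U c t l.
  move=> /subnK <-; elim: (n - n0) => [|b [t1 [l1 sp1]]]; first by exists t, l.
  have nb : N <= b + n0 by lia.
  have b0 : 0 < b + n0 by lia.
  have [_ [U2 [c2 [t2 [l2 [sp2 short Hd]]]]]] := HL _ nb.
  (* [U2] is no longer than [U], being shortest at its level, and no shorter by the choice of
     [r]. *)
  have UU : size U = size U2.
    apply/eqP; rewrite eqn_leq (short _ _ _ _ sp1) andbT Ur.
    by apply: rmin; apply/asboolP; exists (b + n0), U2, c2, t2, l2.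
  have [U21 c21] : U2 = U /\ c2 = c.
    have [_ hU _ HB] := sp1; have [_ hU2 _ HB2] := sp2.
    have [t10 l1c E1] := HB (Ordinal (hyp_a b0)).
    have [t20 l2c E2] := HB2 (Ordinal (hyp_a b0)).
    exact: (semi_inj hU2 hU l2c l1c t20 t10 (esym UU) (etrans (esym E2) E1)).
  by subst U2 c2; apply: (semi_periodic_next b0 sp2 Hd).
have [U0 _ _ _] := sp0.
have w_semi i : w i = nth s (U ++ nseq c s) (i %% (size U + c)).
  (* At this level the block that begins [w] contains position [i]. *)
  have [n1 _ Hn1] := dim_growing i.+1; set n := n1 + n0.
  have [|t1 [l1 [_ _ _ HB]]] := sp n; first by rewrite leq_addl.
  have n_gt0 : 0 < n by rewrite /n; lia.
  have [j _ <-] := coding_block i n_gt0; last by rewrite Hn1 ?leq_addr.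
  have [_ lc bE] := HB j; rewrite bE nth_semi //.
  by rewrite /semi -bE size_word Hn1 ?leq_addr.
have Uc : 0 < size U + c by case: (U) U0.
exists (U ++ nseq c s); split=> [/(congr1 size)|i].
  by rewrite size_cat size_nseq => E; rewrite E in Uc.
rewrite w_semi size_cat size_nseq; apply: set_nth_default.
by rewrite size_cat size_nseq ltn_mod.
Qed.

(** * From periodicity to the local deficit condition *)

Hypothesis x_transitive : forward_transitive x.
Hypothesis w_periodic : periodic w.

Lemma w0_nonspacer : w 0 != s.
Proof.
case: x_unique => -[_ xmin] _; apply/eqP.
apply: (minimal_alpha1 hyp_c (n := 1)) => //; exact: x_nonspacer.
Qed.

(** [adic] fixes a maximal path, so [w] would be eventually and, by periodicity, everywhere
    constant; but [s] occurs in [w] by transitivity, and [w 0 != s]. *)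
Lemma orbit_not_maximal q : ~ maximal (iter q (@adic B) x).
Proof.
move=> qmax; have [p [p0 wp _]] := least_period w_periodic.
have wq i : w i = w q.
  rewrite -(periodM q i wp) -(subnKC (leq_trans (leq_pmulr q p0) (leq_addl i (q * p)))).
  by rewrite codingD /coding iter_adic_max.
have [i wi] := x_transitive (ex_intro _ (xs B) (erefl s)).
by case/eqP: w0_nonspacer; rewrite wq -(wq i).
Qed.

(** A tower over a spacer vertex lasts one step and reads [s], so minimality below [n] persists up
    to the next letter other than [s], where a non-spacer block starts. *)
Lemma next_start n q (j : 'I_(K B n)) : 0 < n ->
    minimal_to (lift ord_max j) (iter q (@adic B) x) ->
  exists a (j' : 'I_(K B n)), occurs s w (block 1 j ++ nseq a s) q /\
    minimal_to (lift ord_max j') (iter (q + dim (lift ord_max j) + a) (@adic B) x).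
Proof.
move=> n0 xq; set Q := q + dim _.
have [p [p0 wp _]] := least_period w_periodic.
have nmax q' r : ~ maximal (iter r (@adic B) (iter q' (@adic B) x)).
  by rewrite -iterD; apply: orbit_not_maximal.
have ex : exists a, w (Q + a) != s.
  (* The position reached is [Q * p], a multiple of the period. *)
  exists (Q * p.-1); rewrite -{1}[Q]muln1 -mulnDr add1n prednK //.
  by rewrite -[Q * p]add0n periodM ?w0_nonspacer.
case: (ex_minnP ex) => a wa amin.
have startQ b : b <= a -> forall m, m < n -> is_min (iter (Q + b) (@adic B) x m).
  elim: b => [|b IHb] ba.
    rewrite addn0 /Q addnC iterD => m mn; have [xv xmin] := xq.
    by rewrite -xv minimal_below_dim.
  have {}IHb := IHb (ltnW ba).
  have xb : src (iter (Q + b) (@adic B) x n) = ord_max.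
    apply: contrapT => /(minimal_alpha1 hyp_c n0 IHb) wb.
    by have := amin b; rewrite ltnNge in ba; move/eqP: wb => -> /(_ isT); apply/negP.
  rewrite addnS => m mn; rewrite -add1n iterD.
  by have := minimal_below_dim (nmax (Q + b)) IHb mn; rewrite xb dim_spacer.
have [|j' xj'] := @nonspacerE _ n (src (iter (Q + a) (@adic B) x n)).
  move=> xa; case/eqP: wa; have ya : minimal_to (ord_max : 'I_(K B n).+1) (iter (Q + a) (@adic B) x).
    by split; [exact: xa | exact: startQ].
  have := nth_word n0 ya (i := 0); rewrite dim_spacer word_spacer // => /(_ isT).
  by rewrite -codingD addn0.
exists a, j'; split; last by split; [exact: xj' | exact: startQ].
apply/occurs_cat; split; first exact: occurs_word.
apply/occurs_nseq => b ba; rewrite blockE size_word -/Q; apply/eqP.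
by apply: contraTT ba => /amin; rewrite -leqNgt.
Qed.

Lemma periodic_LDC : exists N, forall n, N <= n -> LDC B n 1.
Proof.
have w0 := w0_nonspacer.
have [p [p0 wp wleast]] := least_period w_periodic.
have [U [c [wUc lastU]]] := split_trailing s (mkseq w p).
have {}lastU : last s U != s.
  case: lastU => // U0; case/eqP: w0; have := nth_mkseq s w p0.
  by rewrite wUc U0 nth_nseq if_same.
have headU : head s U != s.
  case: (U) wUc lastU => [_|a V]; rewrite /= ?eqxx // => wE _.
  by have := nth_mkseq s w p0; rewrite wE /= => ->.
have cp := trailing_lt wUc lastU.
(* Blocks have length at least [p] from level [n0] on, and at least [3 * p], as [semi_shortest]
   requires, from [M1] on; from [M0] on minimal paths to non-spacer vertices follow [x] up to level
   [n0]. *)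
have [n0 n0_gt0 Hn0] := dim_growing p.
have [M0 HM0] := minimal_agree hyp_c x_unique n0.
have [M1 M1_gt0 HM1] := dim_growing (3 * p).
have big m (j : 'I_(K B m)) : M1 <= m -> 3 * p <= size (block 1 j).
  by move=> Mm; rewrite size_word HM1.
(* Below level [n0] a minimal path to [v(m, j)] agrees with [x], so the block
   begins with a period of [w]. *)
have phase m (j : 'I_(K B m)) q : maxn M0 M1 <= m ->
    occurs s w (block 1 j) q -> p %| q.
  rewrite geq_max => /andP[M0m M1m] occ.
  apply/wleast/(period_window p0 wp) => i ip.
  have m0 : 0 < m by lia.
  have ib : i < size (block 1 j) by have := big m j M1m; lia.
  rewrite occ // blockE; have [y [yv ymin]] := minimal_to_ex (lift ord_max j).
  have yx : forall i, i < n0 -> y i = x i.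
    by apply: (HM0 m y M0m ymin); rewrite yv; apply: lift_nonspacer.
  rewrite (@nth_word _ 1 m _ y) -?(size_word 1) //.
  have [j0 xj0 xw] := coding_block i n0_gt0.
  have ilt : i < dim (lift ord_max j0) by have := Hn0 n0 j0 (leqnn _); lia.
  rewrite -xw // blockE (@nth_word _ 1 n0 _ y) //; split.
    rewrite -xj0; case: (n0) n0_gt0 yx => // n _ yx; by rewrite -!bpP yx.
  move=> i' i'lt; rewrite yx //; by case: x_unique => -[_ xmin] _; apply: xmin.
exists (maxn M0 M1) => m Mm.
have /andP[M0m M1m] : (M0 <= m) && (M1 <= m) by rewrite -geq_max.
have m0 : 0 < m by lia.
(* [(f j).1] is the gap seen after one occurrence of the block, the future [c - l j]; [(f j).2] is
   the future [t j]. *)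
have /choice[f Hf] : forall j : 'I_(K B m), exists b : nat * nat,
    [/\ b.1 <= c, p %| dim (lift ord_max j) + b.1, 0 < b.2
      & block 1 j = semi s U c b.2 (c - b.1)].
  move=> j; have [q xq] := minimal_to_exists_iter (lift ord_max j) m0 x_transitive.
  have [a [j' [occ xq']]] := next_start m0 xq.
  have bj := big m j M1m.
  have occj : occurs s w (block 1 j) q by move/occurs_cat: occ => [].
  have pq : p %| q by apply: phase occj.
  have pq' : p %| q + size (block 1 j) + a.
    by rewrite size_word; apply: (phase m j') => //; apply: occurs_word xq'.
  have pj : p < size (block 1 j) by lia.
  have ac := gap_le p0 wp wUc lastU (ltnW (leq_ltn_trans p0 pj)) pq' occ.
  have [t t0 jE] := gap_word p0 wp wUc lastU pj pq pq' occ.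
  exists (a, t); split=> //=.
  by move: pq'; rewrite -addnA dvdn_addr // size_word.
have sp : @semi_periodic_with B 1 m U c (fun j => (f j).2) (fun j => c - (f j).1).
  split=> // [|j]; first by apply: contraNneq lastU => ->.
  by have [fc _ t0 jE] := Hf j; split=> //; apply: leq_subr.
split; first by split=> //; exists U, c, (fun j => (f j).2), (fun j => c - (f j).1).
exists U, c, (fun j => (f j).2), (fun j => c - (f j).1); split=> //.
  move=> U' c' t l [_ _ lastU' HB]; have [t0 lc jE] := HB (Ordinal (hyp_a m0)).
  have [q xq] := minimal_to_exists_iter (lift ord_max (Ordinal (hyp_a m0))) m0 x_transitive.
  have occ : occurs s w (block 1 (Ordinal (hyp_a m0))) q by apply: occurs_word xq.
  have := big m (Ordinal (hyp_a m0)) M1m.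
  have pq := phase _ _ _ Mm occ; rewrite jE in occ * => bj.
  exact: (semi_shortest p0 wp wleast wUc lastU w0 pq bj t0 lc lastU' occ).
move=> i; have [d [j [a iE]]] := explicit_decomposition_ex hyp_c i m0.
have [q xq] := minimal_to_exists_iter (lift ord_max i) (ltn0Sn m) x_transitive.
have [a' [j' [occ xq']]] := next_start (ltn0Sn m) xq.
have pq' : p %| q + size (block 1 i) + a'.
  rewrite size_word; apply: (phase m.+1 j'); first exact: leqW.
  exact: occurs_word xq'.
(* The gap after the last block runs on into the [a'] spacers that follow the whole block in [w], so
   [a] itself is only bounded. *)
suff [dP aE] : (forall b, b \in d -> b.2 = (f b.1).1) /\ a + a' = (f j).1.
  exists d, j, a; split=> // [b bd|]; first by have [fc _ _ _] := Hf b.1; rewrite dP ?subKn.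
  by have [fc _ _ _] := Hf j; rewrite subKn // -aE leq_addr.
rewrite (block_explicit m0 iE) {iE xq xq'} in occ pq'.
have gap b j1 q1 : p %| q1 + size (block 1 j1) + b ->
    occurs s w (block 1 j1 ++ nseq b s) q1 -> b = (f j1).1.
  move=> pq1 occ1; have [fc pf _ _] := Hf j1.
  have j0 : 0 < size (block 1 j1) by rewrite size_word dim_gt0.
  have p1 : p %| q1 by apply: (phase m j1) => //; move/occurs_cat: occ1 => [].
  have bc := gap_le p0 wp wUc lastU j0 pq1 occ1.
  apply: (gap_uniq wUc lastU bc fc _ pf).
  by move: pq1; rewrite -addnA dvdn_addr // size_word.
elim: d q occ pq' => [|[j1 a1] d IHd] q /=.
  rewrite cats0 -!catA -nseqD => occ pq'; split=> //; apply: gap occ.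
  by move: pq'; rewrite size_cat size_nseq !addnA.
rewrite -catA => /occurs_cat[occ1 occ2] pq'.
(* The next block of the list starts at this position, so [phase] applies to it. *)
have p2 : p %| q + size (block 1 j1 ++ nseq a1 s).
  case: (d) occ2 => [|[j2 a2] d'] /=; rewrite -?catA => /occurs_cat[occ2 _].
    exact: phase Mm occ2.
  exact: phase Mm occ2.
have [|dP aE] := IHd _ occ2; first by move: pq'; rewrite size_cat !addnA.
split=> // b; rewrite inE => /orP[/eqP->|/dP//] /=.
by apply: gap occ1; move: p2; rewrite size_cat size_nseq !addnA.
Qed.

End Equivalence.

Theorem theorem4p15 (B : bratteli)
  (hyp_a : forall n, 1 <= n -> 1 <= K B n)
  (hyp_c : forall n, 1 <= n -> forall e : edge B n,
     rng e <> ord_max -> is_min e -> src e <> ord_max)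
  (hyp_d : growing B)
  (x : bpath B)
  (x_unique : unique (fun y : bpath B => y <> xs B /\ minimal y) x)
  (x_transitive : forward_transitive x) :
  periodic (coding 1 x) <-> exists N, forall n, N <= n -> LDC B n 1.
Proof.
split=> [|[N]]; last exact: LDC_periodic.
exact: periodic_LDC.
Qed.
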